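(* Let $A$ be an $n\times m$ toroidal partially filled array in which every row and every column contains at least one filled cell, and let $|F(A)|$ be its number of filled cells. If $P(A)$ has a solution, then: 1) $A$ is a minimal closed subarray, i.e. the only closed subarray $\mathcal{R}\cap\mathcal{C}$ of $A$ containing at least one filled cell is $A$ itself; 2) $|F(A)|\equiv m+n-1 \pmod 2$.
   Context: Arrays are toroidal: an $n\times m$ array $A$ has rows indexed modulo $n$ and columns modulo $m$ (representatives $1,\dots,n$ and $1,\dots,m$). Each cell is either filled or empty, and $F(A)\subseteq[1,n]\times[1,m]$ is the set of filled cells. For $(i,j)\in F(A)$: - the row successor $s_r((i,j))$ is $(i,j+k)$ with $k\ge1$ minimal such that $(i,j+k)\in F(A)$; - the column successor $s_c((i,j))$ is $(i+k,j)$ with $k\ge1$ minimal such that $(i+k,j)\in F(A)$. Both are permutations of $F(A)$. Given $R=(r_1,\dots,r_n)\in\{-1,1\}^n$ and $C=(c_1,\dots,c_m)\in\{-1,1\}^m$, the move function $S_{R,C}:F(A)\to F(A)$ is $S_{R,C}((i,j))=s_c^{\,c_{j'}}((i,j'))$, where $(i,j')=s_r^{\,r_i}((i,j))$; an exponent $-1$ means the inverse permutation. For $(i,j)\in F(A)$, let $L(i,j)=((i,j),S_{R,C}((i,j)),\dots,S_{R,C}^p((i,j)))$, where $p\ge0$ is minimal with $S_{R,C}^{p+1}((i,j))=(i,j)$. The pair $R,C$ is a solution of $P(A)$ if $L(i,j)$ covers all of $F(A)$ for some (equivalently every) filled $(i,j)$, i.e. $S_{R,C}$ is a single cycle on $F(A)$.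 ''$P(A)$ has a solution'' means such $R,C$ exist. Closed subarrays: for a list $\mathcal{R}$ of rows and a list $\mathcal{C}$ of columns of $A$, the subarray $\mathcal{R}\cap\mathcal{C}$ is closed if $F(\mathcal{R}\cap\mathcal{C})=F(\mathcal{R}\cup\mathcal{C})$. This means every filled cell lying in a row of $\mathcal{R}$ or a column of $\mathcal{C}$ lies in both. A closed subarray is minimal if it is minimal with respect to inclusion. *)

(* Defs.v *)
From mathcomp Require Import all_boot all_order all_algebra all_fingroup.

Set Implicit Arguments.
Unset Strict Implicit.
Unset Printing Implicit Defensive.

Section Successor.

Variables (T : finType) (t : T -> T).
Hypothesis t_inj : injective t.
Variable A : {set T}.

Lemma return_ex (x : {x | x \in A}) :
  exists k, (0 < k) && (iter k t (val x) \in A).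
Proof.
exists (fingraph.order t (val x)).
by rewrite fingraph.order_gt0 fingraph.iter_order // (valP x).
Qed.

Definition return_time (x : {x | x \in A}) : nat := ex_minn (return_ex x).

Lemma return_in (x : {x | x \in A}) : iter (return_time x) t (val x) \in A.
Proof. by rewrite /return_time; case: ex_minnP => k /andP[]. Qed.

Definition successor (x : {x | x \in A}) : {x | x \in A} :=
  exist _ (iter (return_time x) t (val x)) (return_in x).

Lemma successor_inj : injective successor.
Proof.
have key (x y : {x | x \in A}) : return_time x <= return_time y ->
    iter (return_time x) t (val x) = iter (return_time y) t (val y) -> x = y.
  move=> le_xy; rewrite -(subnKC le_xy) iterD.
  have iter_inj k : injective (iter k t) by elim: k => //= k IHk u v /t_inj/IHk.
  move/iter_inj => xE; apply: val_inj; rewrite xE.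
  case: (posnP (return_time y - return_time x)) => [-> // | d_gt0].
  have x_gt0 : 0 < return_time x.
    by rewrite /return_time; case: ex_minnP => k /andP[].
  have : return_time y <= return_time y - return_time x.
    rewrite {1}/return_time; case: ex_minnP => k _; apply.
    by rewrite d_gt0 -xE (valP x).
  by rewrite leqNgt ltn_subrL x_gt0 (leq_trans x_gt0 le_xy).
move=> x y /(congr1 val) /= E.
by case/orP: (leq_total (return_time x) (return_time y)) => H;
  [|apply/esym]; apply: key.
Qed.

Definition successor_perm : {perm {x | x \in A}} := perm successor_inj.

End Successor.

(* A cell is a pair (row, column); an array is identified with its set F(A) of
   filled cells, since the entries play no role. [ordS] is the cyclic
   successor, so coordinates are read modulo n and m. *)
Definition array (n m : nat) := {set 'I_n * 'I_m}.

Definition filled n m (A : array n m) : finType := {x : 'I_n * 'I_m | x \in A}.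

Definition right n m (x : 'I_n * 'I_m) : 'I_n * 'I_m := (x.1, ordS x.2).
Definition down n m (x : 'I_n * 'I_m) : 'I_n * 'I_m := (ordS x.1, x.2).

Lemma right_inj n m : injective (@right n m).
Proof. by move=> [i j] [k l] /eqP/andP[/eqP /= -> /eqP/ordS_inj /= ->]. Qed.

Lemma down_inj n m : injective (@down n m).
Proof. by move=> [i j] [k l] /eqP/andP[/eqP/ordS_inj /= -> /eqP /= ->]. Qed.

Definition row_succ n m (A : array n m) : {perm filled A} :=
  successor_perm (@right_inj n m) A.
Definition col_succ n m (A : array n m) : {perm filled A} :=
  successor_perm (@down_inj n m) A.

Definition perm_expz (T : finType) (s : {perm T}) (e : int) : {perm T} :=
  match e with Posz k => (s ^+ k)%g | Negz k => (s ^- k.+1)%g end.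

Definition move n m (A : array n m) (R : 'I_n -> int) (C : 'I_m -> int)
    (x : filled A) : filled A :=
  let y := perm_expz (row_succ A) (R (val x).1) x in
  perm_expz (col_succ A) (C (val y).2) y.

Definition is_sign_vector k (v : 'I_k -> int) : Prop :=
  forall i, v i = 1%R \/ v i = (-1)%R.

(* The list L(x): x, S x, ..., S^p x with p >= 0 minimal such that
   S^(p+1) x = x. Since S = move R C is a permutation, this is its orbit list,
   [fingraph.orbit]. *)
Definition move_cycle n m (A : array n m) (R : 'I_n -> int) (C : 'I_m -> int)
    (x : filled A) : seq (filled A) :=
  fingraph.orbit (move R C) x.

Lemma move_inj n m (A : array n m) (R : 'I_n -> int) (C : 'I_m -> int) :
  injective (@move n m A R C).
Proof.
have expz_row (e : int) (x : filled A) :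
    (val (perm_expz (row_succ A) e x)).1 = (val x).1.
  have H1 (y : filled A) : (val (row_succ A y)).1 = (val y).1.
    by rewrite permE /=; elim: (return_time _ _) => //= k <-.
  have HX k (y : filled A) : (val ((row_succ A ^+ k)%g y)).1 = (val y).1.
    by elim: k y => [|k IH] y; rewrite ?expg0 ?perm1 // expgS permM IH H1.
  case: e => k; first exact: HX.
  by rewrite /perm_expz -[in RHS](permKV (row_succ A ^+ k.+1)%g x) HX.
have expz_col (e : int) (x : filled A) :
    (val (perm_expz (col_succ A) e x)).2 = (val x).2.
  have H1 (y : filled A) : (val (col_succ A y)).2 = (val y).2.
    by rewrite permE /=; elim: (return_time _ _) => //= k <-.
  have HX k (y : filled A) : (val ((col_succ A ^+ k)%g y)).2 = (val y).2.
    by elim: k y => [|k IH] y; rewrite ?expg0 ?perm1 // expgS permM IH H1.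
  case: e => k; first exact: HX.
  by rewrite /perm_expz -[in RHS](permKV (col_succ A ^+ k.+1)%g x) HX.
move=> x y; rewrite /move => E.
have E2 := congr1 (fun z : filled A => (val z).2) E; rewrite /= !expz_col in E2.
rewrite E2 in E; move/perm_inj: E => E.
have E1 := congr1 (fun z : filled A => (val z).1) E; rewrite /= !expz_row in E1.
by rewrite E1 in E; move/perm_inj: E.
Qed.

Lemma move_cycleP n m (A : array n m) (R : 'I_n -> int) (C : 'I_m -> int)
    (x : filled A) :
  exists p, [/\ move_cycle R C x = traject (move R C) x p.+1,
    iter p.+1 (move R C) x = x
    & forall q, iter q.+1 (move R C) x = x -> p <= q].
Proof.
have f_inj := @move_inj n m A R C.
exists (fingraph.order (move R C) x).-1.
rewrite fingraph.orderSpred; split=> //; first exact: fingraph.iter_order.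
move=> q qx; rewrite -ltnS fingraph.orderSpred leqNgt; apply/negP => lt_q.
have := fingraph.findex_iter lt_q; rewrite qx.
by have := fingraph.findex_iter (fingraph.order_gt0 (move R C) x) => /= ->.
Qed.

Definition is_solution n m (A : array n m) (R : 'I_n -> int) (C : 'I_m -> int)
    : Prop :=
  [/\ is_sign_vector R, is_sign_vector C
    & exists x : filled A, forall y : filled A, y \in move_cycle R C x].

Definition has_solution n m (A : array n m) : Prop :=
  exists (R : 'I_n -> int) (C : 'I_m -> int), is_solution A R C.

Definition filled_inter n m (A : array n m) (Rs : {set 'I_n}) (Cs : {set 'I_m})
    : {set 'I_n * 'I_m} :=
  [set x in A | (x.1 \in Rs) && (x.2 \in Cs)].

Definition filled_union n m (A : array n m) (Rs : {set 'I_n}) (Cs : {set 'I_m})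
    : {set 'I_n * 'I_m} :=
  [set x in A | (x.1 \in Rs) || (x.2 \in Cs)].

Definition closed_subarray n m (A : array n m)
    (Rs : {set 'I_n}) (Cs : {set 'I_m}) : Prop :=
  filled_inter A Rs Cs = filled_union A Rs Cs.

(* Only subarrays containing a filled cell compete: the empty one is always
   closed, so minimality would otherwise be void. *)
Definition minimal_closed_subarray n m (A : array n m)
    (Rs : {set 'I_n}) (Cs : {set 'I_m}) : Prop :=
  [/\ closed_subarray A Rs Cs, filled_inter A Rs Cs != set0
    & forall (Rs' : {set 'I_n}) (Cs' : {set 'I_m}),
        Rs' \subset Rs -> Cs' \subset Cs ->
        closed_subarray A Rs' Cs' -> filled_inter A Rs' Cs' != set0 ->
        Rs' = Rs /\ Cs' = Cs].

(* Main.v *)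
(** The row step and the column step of the move function are permutations of
    the filled cells whose cycles are exactly the [n] rows and the [m] columns.
    A permutation of a set [F] with [k] cycles has the parity of [|F| + k]; the
    move function is the product of the two steps and has a single cycle, hence
    [|F| + 1 = (|F| + n) + (|F| + m)] modulo 2. A closed subarray is stable
    under both steps, so it contains the whole single cycle once it contains a
    filled cell. *)

Require Import Defs.
From mathcomp Require Import all_boot all_order all_algebra all_fingroup.

Set Implicit Arguments.
Unset Strict Implicit.
Unset Printing Implicit Defensive.

Section SuccessorOrbit.

Variables (T : finType) (t : T -> T).
Hypothesis t_inj : injective t.
Variable A : {set T}.

(** Strong induction on [k]: since [y] is itself in [A], the first return of [x] happens no later
    than [y], so passing to the successor leaves strictly fewer steps of [t] to go. *)
Lemma porbit_successor_iter (x y : {x | x \in A}) (k : nat) :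
  val y = iter k t (val x) -> y \in porbit (successor_perm t_inj A) x.
Proof.
elim/ltn_ind: k x => -[|k] IH x Ey.
  by rewrite (val_inj Ey) porbit_id.
rewrite -(porbit_perm _ 1) expg1 permE.
have [ret_gt0 ret_le] : 0 < return_time t_inj x /\ return_time t_inj x <= k.+1.
  rewrite /return_time; case: ex_minnP => r /andP[r_gt0 _] r_min; split=> //.
  by apply: r_min; rewrite -Ey (valP y).
apply: (IH (k.+1 - return_time t_inj x)); first by rewrite ltn_subrL ret_gt0.
by rewrite /= -iterD subnK.
Qed.

End SuccessorOrbit.

Section SignedPerm.

Variables (T : finType) (I : finType) (f : T -> I) (s : {perm T}).
Hypothesis f_s : forall x, f (s x) = f x.

Lemma perm_expz_fibre (e : int) (x : T) : f (perm_expz s e x) = f x.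
Proof.
have fX k y : f ((s ^+ k)%g y) = f y.
  by elim: k y => [|k IH] y; rewrite ?expg0 ?perm1 // expgS permM IH f_s.
case: e => k; first exact: fX.
by rewrite /perm_expz -[in RHS](permKV (s ^+ k.+1)%g x) fX.
Qed.

Variable e : I -> int.

(** The exponent depends only on the fibre of [f], which every power of [s] preserves; so two points
    with the same image were moved by the same power of [s]. *)
Lemma signed_inj : injective (fun x => perm_expz s (e (f x)) x).
Proof.
move=> x y E; have := congr1 f E; rewrite !perm_expz_fibre => fE.
by move: E; rewrite fE => /perm_inj.
Qed.

Definition signed_perm : {perm T} := perm signed_inj.

Lemma signed_permX k x : (signed_perm ^+ k)%g x = (perm_expz s (e (f x)) ^+ k)%g x.
Proof.
elim: k => [|k IH]; first by rewrite !expg0.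
(* It remains to see that the exponent read at the [k]-th iterate is the one read at [x]. *)
rewrite !expgSr !permM IH permE; congr (perm_expz s (e _) _).
elim: k {IH} => [|k IH]; first by rewrite expg0 perm1.
by rewrite expgSr permM perm_expz_fibre.
Qed.

(** On the fibre of [x] the signed permutation is either [s] or its inverse, and these have the same
    cycles. *)
Lemma porbit_signed_perm x :
  (forall i, e i = 1%R \/ e i = (-1)%R) -> porbit signed_perm x = porbit s x.
Proof.
move=> e_sign; have -> : porbit signed_perm x = porbit (perm_expz s (e (f x))) x.
  by apply/setP => y; apply/porbitP/porbitP => -[k ->]; exists k;
    rewrite signed_permX.
by case: (e_sign (f x)) => ->; rewrite /= expg1 ?porbitV.
Qed.

(** The cycles are the fibres of [f]; surjectivity makes each fibre nonempty, so distinct indices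
    give distinct cycles. *)
Lemma card_porbits_fibres (g : {perm T}) :
    (forall x y, (y \in porbit g x) = (f y == f x)) ->
    (forall i, exists x, f x = i) ->
  #|porbits g| = #|I|.
Proof.
move=> gP f_surj; pose h i := [set y | f y == i].
have -> : porbits g = h @: setT.
  apply/setP => B; apply/imsetP/imsetP => [[x _ ->]|[i _ ->]].
    by exists (f x) => //; apply/setP => y; rewrite gP inE.
  have [x fx] := f_surj i; exists x => //.
  by apply/setP => y; rewrite gP inE fx.
rewrite card_imset ?cardsT // => i j /setP E.
by have [x fx] := f_surj i; have := E x; rewrite !inE fx eqxx => /esym/eqP.
Qed.

End SignedPerm.

Section Array.

Variables (n m : nat) (A : array n m).

Definition row_of (x : filled A) : 'I_n := (val x).1.
Definition col_of (x : filled A) : 'I_m := (val x).2.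

Lemma row_of_row_succ x : row_of (row_succ A x) = row_of x.
Proof. by rewrite /row_of permE /=; elim: (return_time _ _) => //= k <-. Qed.

Lemma col_of_col_succ x : col_of (col_succ A x) = col_of x.
Proof. by rewrite /col_of permE /=; elim: (return_time _ _) => //= k <-. Qed.

Lemma iter_ordS_transitive p (i j : 'I_p) : exists k, iter k (@ordS p) i = j.
Proof.
have iterE k : val (iter k (@ordS p) i) = (i + k) %% p.
  elim: k => [|k IH]; first by rewrite addn0 modn_small.
  by rewrite iterS /= IH addnS -addn1 modnDml addn1.
(* [p - i] steps wrap [i] around to 0, and [j] more reach [j]. *)
exists (p - i + j); apply: val_inj; rewrite iterE addnA.
by rewrite subnKC ?(ltnW (ltn_ord i)) // modnDl modn_small.
Qed.

Lemma porbit_row_succ x y : (y \in porbit (row_succ A) x) = (row_of y == row_of x).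
Proof.
apply/idP/eqP => [/porbitP[k ->]|rowE].
  exact: (perm_expz_fibre row_of_row_succ k).
(* Conversely, walking right along the common row reaches [y]. *)
have [k kE] := iter_ordS_transitive (col_of x) (col_of y).
apply: (@porbit_successor_iter _ _ _ _ _ _ k).
have -> : iter k (@right n m) (val x) = (row_of x, iter k (@ordS m) (col_of x)).
  by elim: k {kE} => [|k IH] /=; [apply: surjective_pairing | rewrite IH].
by rewrite kE -rowE; apply: surjective_pairing.
Qed.

Lemma porbit_col_succ x y : (y \in porbit (col_succ A) x) = (col_of y == col_of x).
Proof.
apply/idP/eqP => [/porbitP[k ->]|colE].
  exact: (perm_expz_fibre col_of_col_succ k).
have [k kE] := iter_ordS_transitive (row_of x) (row_of y).
apply: (@porbit_successor_iter _ _ _ _ _ _ k).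
have -> : iter k (@down n m) (val x) = (iter k (@ordS n) (row_of x), col_of x).
  by elim: k {kE} => [|k IH] /=; [apply: surjective_pairing | rewrite IH].
by rewrite kE -colE; apply: surjective_pairing.
Qed.

Variables (R : 'I_n -> int) (C : 'I_m -> int).

Definition row_step : {perm filled A} := signed_perm row_of_row_succ R.
Definition col_step : {perm filled A} := signed_perm col_of_col_succ C.

Lemma moveE x : move R C x = (row_step * col_step)%g x.
Proof. by rewrite permM !permE. Qed.

Lemma row_of_row_step x : row_of (row_step x) = row_of x.
Proof. by rewrite permE (perm_expz_fibre row_of_row_succ). Qed.

Lemma col_of_col_step x : col_of (col_step x) = col_of x.
Proof. by rewrite permE (perm_expz_fibre col_of_col_succ). Qed.

Lemma iter_moveE k x : iter k (move R C) x = ((row_step * col_step) ^+ k)%g x.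
Proof.
elim: k => [|k IH]; first by rewrite expg0 perm1.
by rewrite iterS IH moveE -permM -expgSr.
Qed.

Lemma move_cycle_porbit x y :
  y \in move_cycle R C x -> y \in porbit (row_step * col_step)%g x.
Proof.
rewrite /move_cycle -fingraph.fconnect_orbit => /fingraph.iter_findex <-.
by rewrite iter_moveE mem_porbit.
Qed.

(** A filled cell with exactly one selected coordinate would lie in the union but not in the
    intersection. *)
Lemma closed_subarray_cell Rs Cs (x : filled A) :
  closed_subarray A Rs Cs -> (row_of x \in Rs) = (col_of x \in Cs).
Proof.
move/setP/(_ (val x)); rewrite !inE (valP x) /= /row_of /col_of.
by case: (_ \in Rs); case: (_ \in Cs).
Qed.

(** The row step keeps membership in [Rs]; closedness trades it for membership in [Cs], which the
    column step keeps, and trades it back. *)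
Lemma closed_subarray_porbit Rs Cs x y :
    closed_subarray A Rs Cs -> y \in porbit (row_step * col_step)%g x ->
  (row_of y \in Rs) = (row_of x \in Rs).
Proof.
move=> clRC /porbitP[k ->]; elim: k => [|k IH]; first by rewrite expg0 perm1.
rewrite expgSr permM -{}IH permM (closed_subarray_cell _ clRC).
by rewrite col_of_col_step -(closed_subarray_cell _ clRC) row_of_row_step.
Qed.

End Array.

Theorem theorem2p7 (n m : nat) (A : array n m)
  (hrow : forall i : 'I_n, exists j : 'I_m, (i, j) \in A)
  (hcol : forall j : 'I_m, exists i : 'I_n, (i, j) \in A)
  (hsol : has_solution A) :
  minimal_closed_subarray A [set: 'I_n] [set: 'I_m] /\
  #|A| = m + n - 1 %[mod 2].
Proof.
have [R [C [R_sign C_sign [x0 cycle_x0]]]] := hsol.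
have one_cycle y := move_cycle_porbit (cycle_x0 y).
split.
  split=> [||Rs Cs _ _ clRC].
  - by apply/setP => x; rewrite !inE.
  - by apply/set0Pn; exists (val x0); rewrite !inE (valP x0).
  case/set0Pn => z; rewrite inE => /andP[zA /andP[zR _]].
  (* Both [y] and [z] lie on the cycle of [x0], and the row of [z] is selected. *)
  have inRs (y : filled A) : row_of y \in Rs.
    rewrite (closed_subarray_porbit clRC (one_cycle y)).
    pose z' : filled A := exist _ z zA.
    by rewrite -(closed_subarray_porbit clRC (one_cycle z')).
  split; apply/setP => i; rewrite inE.
    by have [j ijA] := hrow i; apply: (inRs (exist _ (i, j) ijA)).
  have [j jiA] := hcol i.
  have := inRs (exist _ (j, i) jiA).
  by rewrite (closed_subarray_cell _ clRC).
have card_rows : #|porbits (row_step A R)| = n.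
  rewrite -[RHS]card_ord; apply: (card_porbits_fibres (f := @row_of n m A)) => [x y|i].
    by rewrite porbit_signed_perm // porbit_row_succ.
  by have [j ijA] := hrow i; exists (exist _ (i, j) ijA).
have card_cols : #|porbits (col_step A C)| = m.
  rewrite -[RHS]card_ord; apply: (card_porbits_fibres (f := @col_of n m A)) => [x y|j].
    by rewrite porbit_signed_perm // porbit_col_succ.
  by have [i ijA] := hcol j; exists (exist _ (i, j) ijA).
have card_move : #|porbits (row_step A R * col_step A C)%g| = 1.
  rewrite -[RHS]card_unit.
  (* A single cycle is the single fibre of the constant map to [unit]. *)
  apply: (card_porbits_fibres (f := fun=> tt)) => [x y|[]]; last by exists x0.
  have /eqP -> : porbit (row_step A R * col_step A C)%g x ==
    porbit (row_step A R * col_step A C)%g x0 by rewrite eq_porbit_mem.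
  by rewrite one_cycle.
have cardF : #|filled A| = #|A| by rewrite card_sig; apply: eq_card.
(* Ensures that the subtraction in [m + n - 1] is not truncated. *)
have n_gt0 : 0 < n by case: (row_of x0) => i; apply: leq_trans.
have := odd_permM (row_step A R) (col_step A C).
(* [odd_perm] unfolds to the parity of the number of points plus the number of cycles. *)
rewrite /odd_perm card_rows card_cols card_move cardF => parity.
rewrite !modn2 oddB ?addn_gt0 ?n_gt0 ?orbT // oddD.
by move: parity; case: (odd #|A|); case: (odd n); case: (odd m).
Qed.
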